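(* Let $B\subseteq P+\operatorname{int}(R^k_+)$ be any set and let $S$ be a finite nonempty subset of the inverse image $f^{-1}(B)=\{x\in\mathbb{R}^n\mid f(x)\in B\}$ such that for every $x\in S$ there is no $x'\in S$ with $x'\prec x$, and $y^{nad}\ll f(x)$ for every $x\in S$. Then $S$ is an upper shell for the multiobjective problem of maximizing $f$ over $X_0$.
   Context: Setting: $X_0 \subset \mathbb{R}^n$ is a compact set, $k \ge 2$, $f=(f_1,\dots,f_k):\mathbb{R}^n\to\mathbb{R}^k$ with objective functions $f_l:\mathbb{R}^n\to\mathbb{R}$, $l=1,\dots,k$. The multiobjective problem is to find the set $N$ of efficient elements of $X_0$ (maximization of $f$ over $X_0$). For $y,y'\in\mathbb{R}^k$ write $y \ll y'$ if $y_l \le y'_l$ for all $l=1,\dots,k$ and $y_l<y'_l$ for at least one $l$. The dominance relation on $\mathbb{R}^n$ is: $x\prec x'$ iff $f(x)\ll f(x')$. An element $x\in X_0$ is efficient if there is no $x'\in X_0$ with $x\prec x'$; $N$ is the set of efficient elements, assumed nonempty. $P=f(N)$ is the Pareto front, $R^k_+=\{y\in\mathbb{R}^k \mid y_l\ge 0,\ l=1,\dots,k\}$, $\operatorname{int}$ denotes topological interior, and $P+\operatorname{int}(R^k_+)=\{p+r\mid p\in P,\ r\in \operatorname{int}(R^k_+)\}$. Let $y^{nad}_l=\min_{x\in N} f_l(x)$, $l=1,\dots,k$. Upper shell: a finite nonempty set $S_U\subseteq\mathbb{R}^n\setminus X_0$ such that for every $x\in S_U$: (i) there is no $x'\in S_U$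 with $x'\prec x$; (ii) there is no $x'\in N$ with $x\prec x'$; (iii) $y^{nad}\ll f(x)$. *)

(* Defs.v *)
From HB Require Import structures.
From mathcomp Require Import all_boot all_order all_algebra.
From mathcomp Require Import all_classical all_reals all_analysis.

Set Implicit Arguments.
Unset Strict Implicit.
Unset Printing Implicit Defensive.

Import Order.TTheory GRing.Theory Num.Theory.
Import numFieldNormedType.Exports.

Local Open Scope classical_set_scope.
Local Open Scope ring_scope.

(* Vectors of R^n are row vectors 'rV[R]_n; the l-th objective of
   f : 'rV[R]_n -> 'rV[R]_k is x |-> f x ord0 l. *)

Definition vdom (R : realType) (k : nat) (y y' : 'rV[R]_k) : Prop :=
  (forall l : 'I_k, y ord0 l <= y' ord0 l) /\
  (exists l : 'I_k, y ord0 l < y' ord0 l).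

Definition dominated (R : realType) (n k : nat) (f : 'rV[R]_n -> 'rV[R]_k)
    (x x' : 'rV[R]_n) : Prop :=
  vdom (f x) (f x').

Definition efficient (R : realType) (n k : nat) (f : 'rV[R]_n -> 'rV[R]_k)
    (X0 : set 'rV[R]_n) : set 'rV[R]_n :=
  [set x | X0 x /\ ~ (exists2 x', X0 x' & dominated f x x')].

Definition pareto_front (R : realType) (n k : nat)
    (f : 'rV[R]_n -> 'rV[R]_k) (X0 : set 'rV[R]_n) : set 'rV[R]_k :=
  f @` efficient f X0.

Definition nonneg_orthant (R : realType) (k : nat) : set 'rV[R]_k :=
  [set y | forall l : 'I_k, 0 <= y ord0 l].

Definition minkowski_sum (R : realType) (k : nat) (A C : set 'rV[R]_k) :
    set 'rV[R]_k :=
  [set p + r | p in A & r in C].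

(* The minima need not exist for arbitrary f, so the nadir point is given by
   a relation: each coordinate of ynad is an attained lower bound. *)
Definition is_nadir (R : realType) (n k : nat) (f : 'rV[R]_n -> 'rV[R]_k)
    (X0 : set 'rV[R]_n) (ynad : 'rV[R]_k) : Prop :=
  forall l : 'I_k,
    let values := [set f x ord0 l | x in efficient f X0] in
    values (ynad ord0 l) /\ lbound values (ynad ord0 l).

(* Meaningful when ynad is the nadir point, i.e. is_nadir f X0 ynad. *)
Definition upper_shell (R : realType) (n k : nat) (f : 'rV[R]_n -> 'rV[R]_k)
    (X0 : set 'rV[R]_n) (ynad : 'rV[R]_k) (S : set 'rV[R]_n) : Prop :=
  [/\ finite_set S, S !=set0, S `<=` ~` X0 &
      forall x, S x ->
        [/\ ~ (exists2 x', S x' & dominated f x' x),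
            ~ (exists2 x', efficient f X0 x' & dominated f x x') &
            vdom ynad (f x)]].

(* Main.v *)
(** A point of P + int(R^k_+) strictly exceeds some point f z of the front, with
    z efficient.  Hence z is dominated by every x with f x in B, so x lies outside
    X0, and an efficient x' dominating x would dominate z by transitivity. *)

Require Import Defs.
From HB Require Import structures.
From mathcomp Require Import all_boot all_order all_algebra.
From mathcomp Require Import all_classical all_reals all_analysis.

Set Implicit Arguments.
Unset Strict Implicit.
Unset Printing Implicit Defensive.

Import Order.TTheory GRing.Theory Num.Theory.
Import numFieldNormedType.Exports.

Local Open Scope classical_set_scope.
Local Open Scope ring_scope.

(** An interior point has room to move down in all coordinates at once: if the ball of radius [e]
    around [r] stays in the orthant, lowering every entry by [e / 2] keeps it there, so each entry
    is at least [e / 2]. *)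
Lemma interior_nonneg_orthant_gt0 (R : realType) (k : nat) (r : 'rV[R]_k)
    (l : 'I_k) :
  interior (@nonneg_orthant R k) r -> 0 < r ord0 l.
Proof.
move=> /nbhs_ballP[e /= e0 ball_sub].
have : nonneg_orthant (r - const_mx (e / 2)).
  (* Balls of matrices are entrywise, so it suffices that each entry moves by [e / 2 < e]. *)
  apply: ball_sub; split=> // i j.
  rewrite !mxE /ball /= opprB addrC subrK gtr0_norm ?divr_gt0//.
  by rewrite ltr_pdivrMr// ltr_pMr// ltr1n.
move=> /(_ l); rewrite !mxE subr_ge0; apply: lt_le_trans.
by rewrite divr_gt0.
Qed.

Lemma dominated_trans (R : realType) (n k : nat) (f : 'rV[R]_n -> 'rV[R]_k)
    (x y z : 'rV[R]_n) :
  dominated f x y -> dominated f y z -> dominated f x z.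
Proof.
move=> [xy [l xyl]] [yz _]; split; first by move=> i; exact: le_trans (yz i).
by exists l; exact: lt_le_trans (yz l).
Qed.

Lemma pareto_front_addr_dominated (R : realType) (n k : nat)
    (f : 'rV[R]_n -> 'rV[R]_k) (X0 : set 'rV[R]_n) (x : 'rV[R]_n) :
  (0 < k)%N ->
  minkowski_sum (pareto_front f X0) (interior (@nonneg_orthant R k)) (f x) ->
  exists2 z, efficient f X0 z & dominated f z x.
Proof.
move=> k0 [_ [z Nz <-] [r r_int fx]]; exists z => //.
have lt_fzx l : f z ord0 l < f x ord0 l.
  by rewrite -fx mxE ltrDl interior_nonneg_orthant_gt0.
(* Every coordinate is strict; [k0] ensures that there is one, and index 0 serves as witness. *)
by split=> [l|]; [exact: ltW | exists (Ordinal k0)].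
Qed.

Theorem lemma3 (R : realType) (n k : nat) (hk : (2 <= k)%N)
    (f : 'rV[R]_n -> 'rV[R]_k)
    (X0 : set 'rV[R]_n) (hX0 : compact X0)
    (hN : efficient f X0 !=set0)
    (ynad : 'rV[R]_k) (hnad : is_nadir f X0 ynad)
    (B : set 'rV[R]_k)
    (hB : B `<=` minkowski_sum (pareto_front f X0)
                               (interior (@nonneg_orthant R k)))
    (S : set 'rV[R]_n)
    (hSfin : finite_set S) (hS0 : S !=set0)
    (hSB : S `<=` f @^-1` B)
    (hSdom : forall x, S x -> ~ (exists2 x', S x' & dominated f x' x))
    (hSnad : forall x, S x -> vdom ynad (f x)) :
  upper_shell f X0 ynad S.
Proof.
have below x : S x -> exists2 z, efficient f X0 z & dominated f z x.
  (* [hk] reads [1 < k], which weakens to [1 <= k], that is, [0 < k]. *)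
  by move=> /hSB /hB; apply: pareto_front_addr_dominated; exact: ltnW.
split=> // [x /below[z [_ Nz] zx] X0x | x Sx]; first by apply: Nz; exists x.
split; [exact: hSdom | | exact: hSnad].
(* The contradiction is with the efficiency of [z]: the point [x'] of [X0] dominates it through
   [x]. *)
move=> [x' [X0x' _] xx']; have [z [_ Nz] zx] := below _ Sx.
by apply: Nz; exists x' => //; exact: dominated_trans xx'.
Qed.
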